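(* Let $\mathbf{k}$ be a field of characteristic $0$ and let $(A,\mu,\alpha)$ be a multiplicative right Hom-alternative algebra over $\mathbf{k}$. Then for all $a,b \in A$, \[ \alpha^6\left((a,a,b)^4\right) = 0, \] where $(\cdot,\cdot,\cdot)$ is the Hom-associator of $A$ and $(\cdot)^4$ denotes the fourth Hom-power.
   Context: A Hom-algebra over $\mathbf{k}$ is a triple $(A,\mu,\alpha)$ where $A$ is a $\mathbf{k}$-module, $\mu\colon A^{\otimes 2}\to A$ is a bilinear map (written $xy=\mu(x,y)$; not assumed associative, commutative or unital), and $\alpha\colon A\to A$ is a linear map (the twisting map). It is multiplicative if $\alpha(xy)=\alpha(x)\alpha(y)$ for all $x,y\in A$. The Hom-associator is $(x,y,z)=(xy)\alpha(z)-\alpha(x)(yz)$. $A$ is right Hom-alternative if $(x,y,y)=0$ for all $x,y\in A$. $\alpha^n$ is the $n$-fold composition of $\alpha$, with $\alpha^0=\mathrm{Id}$. The Hom-powers of $x\in A$ are defined by $x^1=x$ and $x^n=x^{n-1}\alpha^{n-2}(x)$ for $n\ge 2$; thus $x^4=((xx)\alpha(x))\alpha^2(x)$. *)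

(* Defs.v *)
From mathcomp Require Import all_boot all_order all_algebra.

Set Implicit Arguments.
Unset Strict Implicit.
Unset Printing Implicit Defensive.

Import GRing.Theory.
Local Open Scope ring_scope.

Definition hom_multiplicative (A : Type) (mu : A -> A -> A) (alpha : A -> A)
  : Prop := forall x y : A, alpha (mu x y) = mu (alpha x) (alpha y).

Definition hom_associator (A : zmodType) (mu : A -> A -> A) (alpha : A -> A)
    (x y z : A) : A :=
  mu (mu x y) (alpha z) - mu (alpha x) (mu y z).

Definition right_hom_alternative (A : zmodType) (mu : A -> A -> A)
    (alpha : A -> A) : Prop :=
  forall x y : A, hom_associator mu alpha x y y = 0.

(* Hom-powers are only defined for n >= 1; the value 0 at n = 0 is a dummy. *)
Fixpoint hom_power (A : zmodType) (mu : A -> A -> A) (alpha : A -> A)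
    (x : A) (n : nat) : A :=
  match n with
  | 0 => 0
  | 1 => x
  | (m.+1 as n').+1 => mu (hom_power mu alpha x n') (iter m alpha x)
  end.

(* Main.v *)
Require Import Defs.
From mathcomp Require Import all_boot all_order all_algebra.

(* Untwisting: on finite sequences of elements of A, place a product of entries
   of degrees i and j in degree i + j + 1 after applying alpha^j and alpha^i to
   them. Every monomial then carries the powers of alpha that make the
   Hom-identities homogeneous, the product is right alternative in the usual
   sense, and with a and b in degree 0 the power (a,a,b)^4 of the ordinary
   algebra is alpha^6 of the Hom-power, in degree 11.

   In a right alternative algebra without 2-torsion, write right
   multiplications as operators acting on the right, so that R is a Jordan
   homomorphism, and put c = yz, e = R_y R_z - R_c, e' = R_z R_y - R_c,
   p = (y,y,z), P = R_p. Then e e' = 0, because it is R_j for a Jordan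
   polynomial j in y, z, c whose value is 0. Polarizing in z with z and zy gives
   e P = - P e' =: u and P^2 = [R_y, u]. Both u^2 = - P e' e P and
   u R_y u = - P e' R_y e P have the form - R_{(pm)p} with pm = 0, since p e' = 0;
   hence p^4 = 0. *)

Set Implicit Arguments.
Unset Strict Implicit.
Unset Printing Implicit Defensive.

Import GRing.Theory.
Local Open Scope ring_scope.

(** * Deciding additive identities by reflection *)

Inductive zmod_expr : Type :=
  | ZVar of nat
  | ZZero
  | ZAdd of zmod_expr & zmod_expr
  | ZOpp of zmod_expr.

Section ZmodReflection.

Variable V : zmodType.

Fixpoint zmod_eval (env : seq V) (e : zmod_expr) : V :=
  match e with
  | ZVar i => nth 0 env i
  | ZZero => 0
  | ZAdd e1 e2 => zmod_eval env e1 + zmod_eval env e2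
  | ZOpp e1 => - zmod_eval env e1
  end.

Fixpoint zmod_coef (e : zmod_expr) (i : nat) : int :=
  match e with
  | ZVar j => if i == j then 1 else 0
  | ZZero => 0
  | ZAdd e1 e2 => zmod_coef e1 i + zmod_coef e2 i
  | ZOpp e1 => - zmod_coef e1 i
  end.

Lemma zmod_evalE env e :
  zmod_eval env e = \sum_(i < size env) nth 0 env i *~ zmod_coef e i.
Proof.
elim: e => [j||e1 IH1 e2 IH2|e IH] /=; last 2 first.
- by rewrite IH1 IH2 -big_split /=; apply: eq_bigr => i _; rewrite mulrzDr.
- by rewrite IH -sumrN; apply: eq_bigr => i _; rewrite mulrNz.
- have [lt_j|le_j] := ltnP j (size env).
    rewrite (bigD1 (Ordinal lt_j)) //= eqxx mulr1z big1 ?addr0 // => i ne_ij.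
    by rewrite ifN ?mulr0z.
  rewrite nth_default // big1 // => i _.
  by rewrite ifN ?mulr0z // ltn_eqF ?(leq_trans _ le_j).
- by rewrite big1 // => i _; rewrite mulr0z.
Qed.

(** On closed expressions the premise is settled by computation, so [erefl] proves it in [zmod]. *)
Lemma zmod_eval_eq env e1 e2 :
    all (fun i => zmod_coef e1 i == zmod_coef e2 i) (iota 0 (size env)) ->
  zmod_eval env e1 = zmod_eval env e2.
Proof.
move=> /allP eq12; rewrite !zmod_evalE; apply: eq_bigr => i _.
by rewrite (eqP (eq12 i _)) // mem_iota /= ltn_ord.
Qed.

End ZmodReflection.

Ltac zmod_index x env :=
  match env with
  | x :: _ => constr:(0%N)
  | _ :: ?env' => let n := zmod_index x env' in constr:(n.+1)
  end.

Ltac zmod_atoms t env :=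
  match t with
  | @GRing.zero _ => env
  | @GRing.add _ ?a ?b => let env' := zmod_atoms a env in zmod_atoms b env'
  | @GRing.opp _ ?a => zmod_atoms a env
  | ?a => match env with
          | context [a :: _] => env
          | _ => constr:(a :: env)
          end
  end.

Ltac zmod_reify t env :=
  match t with
  | @GRing.zero _ => constr:(ZZero)
  | @GRing.add _ ?a ?b =>
      let a' := zmod_reify a env in
      let b' := zmod_reify b env in constr:(ZAdd a' b')
  | @GRing.opp _ ?a => let a' := zmod_reify a env in constr:(ZOpp a')
  | ?a => let n := zmod_index a env in constr:(ZVar n)
  end.

Ltac zmod :=
  match goal with
  | |- @eq ?T ?l ?r =>
      let env0 := zmod_atoms l (@nil T) in
      let env := zmod_atoms r env0 in
      let l' := zmod_reify l env in
      let r' := zmod_reify r env in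
      exact: (@zmod_eval_eq _ env l' r' erefl)
  end.

(** Reduces a goal that follows additively from a known equation to a pure additive identity, which
    [zmod] decides. *)
Lemma eq_of_subr_eq (V : zmodType) (a b x y : V) :
  a = b -> x - y = a - b -> x = y.
Proof. by move=> ->; rewrite subrr => /subr0_eq. Qed.

(** * Right alternative algebras without 2-torsion *)

Section RightAlternative.

Variables (B : zmodType) (mul : B -> B -> B).
Local Notation "x ** y" := (mul x y) (at level 40, left associativity).

Hypothesis mulDl : forall x y z, (x + y) ** z = x ** z + y ** z.
Hypothesis mulDr : forall x y z, x ** (y + z) = x ** y + x ** z.
Hypothesis mul_ralt : forall x y, x ** y ** y = x ** (y ** y).
Hypothesis torsion2 : forall x : B, x + x = 0 -> x = 0.

Let mul0l x : 0 ** x = 0.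
Proof. by apply: (addrI (0 ** x)); rewrite -mulDl !addr0. Qed.

Let mul0r x : x ** 0 = 0.
Proof. by apply: (addrI (x ** 0)); rewrite -mulDr !addr0. Qed.

Let mulNl x y : - x ** y = - (x ** y).
Proof. by apply: (addrI (x ** y)); rewrite -mulDl !subrr mul0l. Qed.

Let mulNr x y : x ** - y = - (x ** y).
Proof. by apply: (addrI (x ** y)); rewrite -mulDr !subrr mul0r. Qed.

Let mulE := (mulDl, mulDr, mulNl, mulNr).

Lemma ralt_polarized x y z : x ** y ** z + x ** z ** y = x ** (y ** z) + x ** (z ** y).
Proof.
have := mul_ralt x (y + z); rewrite !mulE !mul_ralt => h.
by apply: (eq_of_subr_eq h); zmod.
Qed.

(** Writing {s,t} = st + ts, one has 2 (yz)y = {y,{y,z}} - {y^2,z}, and polarized right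
    alternativity makes R respect each bracket; 2-torsion-freeness removes the factor 2. *)
Lemma right_moufang x y z : x ** (y ** z ** y) = x ** y ** z ** y.
Proof.
pose s := y ** z + z ** y.
have sE : x ** s = x ** y ** z + x ** z ** y by rewrite mulDr ralt_polarized.
apply/subr0_eq/torsion2.
have xysE : x ** y ** s = x ** y ** y ** z + x ** y ** z ** y.
  by rewrite mulDr ralt_polarized.
have ysE : y ** s + s ** y =
    (y ** z ** y + y ** z ** y) + (y ** y ** z + z ** (y ** y)).
  by rewrite mulDr -ralt_polarized mulDl mul_ralt; zmod.
have := ralt_polarized x y s.
rewrite xysE sE -mulDr ysE !mulDr -ralt_polarized -!mul_ralt mulDl => h.
by apply: (eq_of_subr_eq (esym h)); zmod.
Qed.

Lemma right_moufang_polarized x a b c :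
  x ** (a ** b ** c) + x ** (c ** b ** a) =
  x ** a ** b ** c + x ** c ** b ** a.
Proof.
have := right_moufang x (a + c) b; rewrite !mulE !right_moufang => h.
by apply: (eq_of_subr_eq h); zmod.
Qed.

(* The second operator is the first one with the words in y, z read backwards. *)
Definition assoc_r y z x := x ** y ** z - x ** (y ** z).
Definition assoc_r' y z x := x ** z ** y - x ** (y ** z).

Lemma assoc_r'_assoc_r y z x : assoc_r' y z (assoc_r y z x) = 0.
Proof.
pose c := y ** z.
(* Obtained by expanding (R_y R_z - R_c)(R_z R_y - R_c) and reading each operator word as a product;
   the terms cancel because (y(zz))y = (cz)y and (yz)c = cc. *)
pose j := y ** (z ** z) ** y - (c ** z ** y + y ** z ** c) + c ** c.
have j0 : j = 0 by rewrite /j -mul_ralt -/c; zmod.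
rewrite -(mul0r x) -j0 /j !mulE right_moufang right_moufang_polarized.
by rewrite -!mul_ralt /assoc_r' /assoc_r -/c !mulE; zmod.
Qed.

Lemma assoc_r'_assoc_r_polarized y z w x :
  assoc_r' y w (assoc_r y z x) = - assoc_r' y z (assoc_r y w x).
Proof.
have h : assoc_r' y (z + w) (assoc_r y (z + w) x) =
    assoc_r' y z (assoc_r y z x) + assoc_r' y w (assoc_r y w x).
  by rewrite !assoc_r'_assoc_r addr0.
by apply: (eq_of_subr_eq h); rewrite /assoc_r' /assoc_r !mulE; zmod.
Qed.

(** * Nilpotency of the associator (y,y,z) *)

Section Mikheev.

Variables y z : B.
Let c := y ** z.
Let p := y ** y ** z - y ** (y ** z).
Let e := assoc_r y z.
Let e' := assoc_r' y z.
Let u x := e x ** p.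

Let mul_yzy x : x ** (y ** (z ** y)) = x ** y ** z ** y + x ** p.
Proof.
have -> : y ** (z ** y) = y ** z ** y + p.
  have := ralt_polarized y y z => h; apply: (eq_of_subr_eq (esym h)).
  by rewrite /p; zmod.
by rewrite mulDr right_moufang.
Qed.

(** Substitute R_{zy} = R_y R_z + R_z R_y - R_c and R_{y(zy)} = R_y R_z R_y + P; the same
    substitution gives [e'_zy]. *)
Let e_zy x : assoc_r y (z ** y) x = e (x ** y) - x ** p.
Proof.
rewrite /assoc_r mul_yzy; have := ralt_polarized (x ** y) y z => h.
by apply: (eq_of_subr_eq (esym h)); rewrite /e /assoc_r; zmod.
Qed.

Let e'_zy x : assoc_r' y (z ** y) x = e' x ** y - x ** p.
Proof.
rewrite /assoc_r' mul_yzy; have := ralt_polarized x y z => h.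
apply: (eq_of_subr_eq (congr1 (mul^~ y) (esym h))).
by rewrite /e' /assoc_r' !mulE; zmod.
Qed.

Let e'D a b : e' (a - b) = e' a - e' b.
Proof. by rewrite /e' /assoc_r' !mulE; zmod. Qed.

Let e'_e x : e' (e x) = 0.
Proof. exact: assoc_r'_assoc_r. Qed.

Let e'p : e' p = 0.
Proof. exact: e'_e. Qed.

(** Polarization at z and zy reads e (e' R_y - P) = - (R_y e - P) e', where the e e' terms
    vanish. *)
Let uE x : u x = - e' (x ** p).
Proof.
have := assoc_r'_assoc_r_polarized y z (z ** y) x.
rewrite e'_zy e_zy -/e' -/e e'_e mul0l e'D e'_e => h.
by apply: (eq_of_subr_eq (esym h)); rewrite /u /e /e'; zmod.
Qed.

(** Expand (R_y e - P)(e' R_y - P) = 0, the relation e e' = 0 with zy in place of z. *)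
Let mul_pp x : x ** p ** p = u (x ** y) - u x ** y.
Proof.
have := assoc_r'_assoc_r y (z ** y) x.
rewrite e_zy e'_zy e'D e'_e => h.
by apply: (eq_of_subr_eq h); rewrite (uE x) /u !mulE mul0l; zmod.
Qed.

Let eN x : e (- x) = - e x.
Proof. by rewrite /e /assoc_r !mulE; zmod. Qed.

Let u_u x : u (u x) = 0.
Proof.
(* The Jordan polynomial for e' e, in the order opposite to [j]; only the product pm = e (e' p) is
   shown to vanish. *)
pose m := z ** (y ** y) ** z - (z ** y ** c + c ** y ** z) + c ** c.
have ee' t : e (e' t) = t ** m.
  rewrite /m !mulE right_moufang right_moufang_polarized -!mul_ralt.
  by rewrite /e /e' /assoc_r /assoc_r' -/c !mulE; zmod.
rewrite {1}/u (uE x) eN ee' mulNl -right_moufang -ee' e'p.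
by rewrite /e /assoc_r !mul0l subrr mul0l mul0r oppr0.
Qed.

Let u_y_u x : u (u x ** y) = 0.
Proof.
(* The expansion of e' R_y e: each word of the previous [m] gains one y in the middle. *)
pose m := z ** (y ** y ** y) ** z
  - (z ** (y ** y) ** c + c ** (y ** y) ** z) + c ** y ** c.
have ee' t : e (e' t ** y) = t ** m.
  rewrite /m !mulE !right_moufang right_moufang_polarized -!mul_ralt.
  by rewrite /e /e' /assoc_r /assoc_r' -/c !mulE; zmod.
rewrite {1}/u (uE x) mulNl eN ee' mulNl -right_moufang -ee' e'p mul0l.
by rewrite /e /assoc_r !mul0l subrr mul0l mul0r oppr0.
Qed.

Lemma ralt_associator_pow4 : p ** p ** p ** p = 0.
Proof.
(* Since p is [e y], the fourth power is P^2 applied to [u y], and [mul_pp] leaves only u^2 and u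
   R_y u. *)
have -> : p ** p = u y by [].
by rewrite mul_pp u_u mul0l subr0 u_y_u.
Qed.

End Mikheev.

End RightAlternative.

(** * The truncated graded algebra that absorbs the twist *)

Section GradedUntwisting.

Variables (k : fieldType) (A : lmodType k).
Variables (mu : {bilinear A -> A -> A}) (alpha : {linear A -> A}).
Hypothesis mu_mult : hom_multiplicative mu alpha.
Hypothesis mu_alt : right_hom_alternative mu alpha.
Variable N : nat.

Local Notation B := {ffun 'I_N -> A}.

Lemma iter_linearD n : {morph iter n alpha : x y / x + y}.
Proof. by elim: n => // n IH x y; rewrite !iterS IH linearD. Qed.

Lemma iter_linear0 n : iter n alpha 0 = 0.
Proof. by elim: n => // n IH; rewrite iterS IH linear0. Qed.

Lemma iter_multiplicative n x y :
  iter n alpha (mu x y) = mu (iter n alpha x) (iter n alpha y).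
Proof. by elim: n => // n IH; rewrite !iterS IH mu_mult. Qed.

Lemma hom_associator_skew x y z :
  hom_associator mu alpha x y z = - hom_associator mu alpha x z y.
Proof.
have h : hom_associator mu alpha x (y + z) (y + z) =
    hom_associator mu alpha x y y + hom_associator mu alpha x z z.
  by rewrite !mu_alt addr0.
apply: (eq_of_subr_eq h).
by rewrite /hom_associator (linearD alpha) !(linearDl, linearDr); zmod.
Qed.

(* Zero when n >= N: degrees are truncated. *)
Definition homog (n : nat) (x : A) : B := [ffun i : 'I_N => x *+ (val i == n)].

Definition graded_mul (f g : B) : B :=
  \sum_(i < N) \sum_(j < N)
    homog (i + j).+1 (mu (iter j alpha (f i)) (iter i alpha (g j))).

Local Notation "f ** g" := (graded_mul f g) (at level 40, left associativity).

Lemma homogD n : {morph homog n : x y / x + y}.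
Proof. by move=> x y; apply/ffunP => i; rewrite !ffunE mulrnDl. Qed.

Lemma homog0 n : homog n 0 = 0.
Proof. by apply/ffunP => i; rewrite !ffunE mul0rn. Qed.

Lemma homogN n x : homog n (- x) = - homog n x.
Proof. by apply/ffunP => i; rewrite !ffunE mulNrn. Qed.

Lemma homog_ge n x : (N <= n)%N -> homog n x = 0.
Proof.
move=> le_Nn; apply/ffunP => i; rewrite !ffunE.
by rewrite ltn_eqF ?mulr0n // (leq_trans (ltn_ord i)).
Qed.

Lemma homog_sum (f : B) : f = \sum_(i < N) homog i (f i).
Proof.
apply/ffunP => i; rewrite sum_ffunE (bigD1 i) //= ffunE eqxx mulr1n.
rewrite big1 ?addr0 // => j ne_ji; rewrite ffunE.
by rewrite -[_ == _]/(i == j) eq_sym (negbTE ne_ji).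
Qed.

Lemma graded_mulDl f g h : (f + g) ** h = f ** h + g ** h.
Proof.
rewrite /graded_mul -big_split; apply: eq_bigr => i _ /=.
rewrite -big_split; apply: eq_bigr => j _ /=.
by rewrite ffunE iter_linearD linearDl homogD.
Qed.

Lemma graded_mulDr f g h : f ** (g + h) = f ** g + f ** h.
Proof.
rewrite /graded_mul -big_split; apply: eq_bigr => i _ /=.
rewrite -big_split; apply: eq_bigr => j _ /=.
by rewrite ffunE iter_linearD linearDr homogD.
Qed.

Lemma graded_mul0l f : 0 ** f = 0.
Proof. by apply: (addrI (0 ** f)); rewrite -graded_mulDl !addr0. Qed.

Lemma graded_mul0r f : f ** 0 = 0.
Proof. by apply: (addrI (f ** 0)); rewrite -graded_mulDr !addr0. Qed.

Lemma graded_mul_suml (I : finType) (F : I -> B) g :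
  (\sum_i F i) ** g = \sum_i F i ** g.
Proof.
exact: (big_morph (graded_mul^~ g) (fun x y => graded_mulDl x y g)
  (graded_mul0l g)).
Qed.

Lemma graded_mul_sumr (I : finType) f (F : I -> B) :
  f ** (\sum_i F i) = \sum_i f ** F i.
Proof. exact: (big_morph (graded_mul f) (graded_mulDr f) (graded_mul0r f)). Qed.

(** No bound on i and j is required: i + j + 1 exceeds both, so once a factor is truncated to 0 the
    product is too. *)
Lemma homogM i j x y :
  homog i x ** homog j y = homog (i + j).+1 (mu (iter j alpha x) (iter i alpha y)).
Proof.
have [lt_i|le_i] := ltnP i N; last first.
  rewrite [homog i x]homog_ge // graded_mul0l homog_ge //.
  by rewrite leqW // (leq_trans le_i) // leq_addr.
have [lt_j|le_j] := ltnP j N; last first.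
  rewrite [homog j y]homog_ge // graded_mul0r homog_ge //.
  by rewrite leqW // (leq_trans le_j) // leq_addl.
rewrite /graded_mul (bigD1 (Ordinal lt_i)) //= [X in _ + X]big1 ?addr0; last first.
  move=> i' ne_i; rewrite big1 // => j' _.
  rewrite !ffunE -[val i' == i]/(i' == Ordinal lt_i).
  by rewrite (negbTE ne_i) iter_linear0 linear0l homog0.
rewrite (bigD1 (Ordinal lt_j)) //= [X in _ + X]big1 ?addr0; last first.
  move=> j' ne_j; rewrite !ffunE -[val j' == j]/(j' == Ordinal lt_j).
  by rewrite (negbTE ne_j) iter_linear0 linear0r homog0.
by rewrite !ffunE !eqxx.
Qed.

Lemma graded_mul_sum3l (f g h : B) : f ** g ** h =
  \sum_(i < N) \sum_(j < N) \sum_(l < N)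
    homog i (f i) ** homog j (g j) ** homog l (h l).
Proof.
rewrite {1}(homog_sum f) (graded_mul_suml _ g) (graded_mul_suml _ h).
apply: eq_bigr => i _; rewrite {1}(homog_sum g) graded_mul_sumr.
rewrite (graded_mul_suml _ h).
by apply: eq_bigr => j _; rewrite {1}(homog_sum h) graded_mul_sumr.
Qed.

Lemma graded_mul_sum3r (f g h : B) : f ** (g ** h) =
  \sum_(i < N) \sum_(j < N) \sum_(l < N)
    homog i (f i) ** (homog j (g j) ** homog l (h l)).
Proof.
rewrite {1}(homog_sum f) (graded_mul_suml _ (g ** h)); apply: eq_bigr => i _.
rewrite {1}(homog_sum g) (graded_mul_suml _ h) graded_mul_sumr; apply: eq_bigr => j _.
by rewrite {1}(homog_sum h) (graded_mul_sumr (homog j _)) graded_mul_sumr.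
Qed.

Lemma graded_ralt (torsion2 : forall x : B, x + x = 0 -> x = 0) f g :
  f ** g ** g = f ** (g ** g).
Proof.
(* The extra 1 in the degree of a product supplies the single [alpha] of the Hom-associator; the
   other powers of [alpha] are symmetric enough for [T] to be skew in j and l. *)
pose T (i j l : 'I_N) : B := homog (i + j + l).+2
  (hom_associator mu alpha (iter (j + l) alpha (f i))
    (iter (i + l) alpha (g j)) (iter (i + j) alpha (g l))).
have TN i j l : T i j l = - T i l j.
  by rewrite /T hom_associator_skew homogN addnAC [(l + j)%N]addnC.
apply/subr0_eq.
have -> : f ** g ** g - f ** (g ** g) = \sum_i \sum_j \sum_l T i j l.
  rewrite graded_mul_sum3l graded_mul_sum3r -sumrB; apply: eq_bigr => i _.
  rewrite -sumrB; apply: eq_bigr => j _; rewrite -sumrB; apply: eq_bigr => l _.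
  rewrite !homogM !iter_multiplicative -!iterD addnS addnA -homogN -homogD.
  rewrite /T /hom_associator -!iterS.
  by rewrite [(l + j)%N]addnC [(l + i)%N]addnC.
rewrite big1 // => i _; apply: torsion2.
(* Swapping j and l in the second copy pairs each [T i j l] with its negative. *)
rewrite [X in _ + X]exchange_big -big_split big1 // => j _ /=.
by rewrite -big_split big1 // => l _ /=; rewrite TN addNr.
Qed.

End GradedUntwisting.

Theorem theorem1p1 (k : fieldType) (k_char0 : [pchar k] =i pred0)
  (A : lmodType k) (mu : {bilinear A -> A -> A}) (alpha : {linear A -> A})
  (mu_mult : hom_multiplicative mu alpha)
  (mu_alt : right_hom_alternative mu alpha) (a b : A) :
  iter 6 alpha (hom_power mu alpha (hom_associator mu alpha a a b) 4) = 0.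
Proof.
have torsion2 (x : A) : x + x = 0 -> x = 0.
  move/eqP; rewrite -mulr2n -scaler_nat scaler_eq0 => /orP[|/eqP //].
  by rewrite ((pcharf0P k).1 k_char0).
(* With a and b in degree 0 the associator has degree 2 and its powers degrees 5, 8, 11, so 12
   degrees suffice and [ord_max] reads off the fourth power. *)
have torsion2B (f : {ffun 'I_12 -> A}) : f + f = 0 -> f = 0.
  move=> /ffunP ff0; apply/ffunP => i; rewrite ffunE.
  by apply: torsion2; have := ff0 i; rewrite !ffunE.
have := ralt_associator_pow4 (@graded_mulDl _ _ mu alpha 12)
  (@graded_mulDr _ _ mu alpha 12)
  (graded_ralt mu_mult mu_alt torsion2B) torsion2B
  (homog 12 0 a) (homog 12 0 b).
rewrite !homogM -homogN -homogD /=.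
set w := (_ + - _ : A); rewrite !homogM => /ffunP /(_ ord_max).
(* On both sides the four factors, from left to right, are [w] under alpha^6, alpha^6, alpha^7 and
   alpha^8. *)
by rewrite !ffunE eqxx mulr1n /= !mu_mult.
Qed.
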